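(* Let $\mathcal{C}\subseteq\mathcal{R}$ be any admissible set of relations, $T(L)$ a $\mathcal{C}$-realization, and $V=V_{\mathcal{C}}(T(L))$ the corresponding relation $\mathfrak{gl}_n$-module. Set $\lambda=(l_{n1},\ldots,l_{nn})$ and $\mu=(w_1(L),w_2(L),\ldots,w_n(L))\in\mathfrak{h}^*$. Then: (i) The polyhedra $P_{\mathcal{C}}$ and $P_{\mathcal{C}}(\lambda)$ have the same number of $L$-integral points, and this number is equal to $\dim(V)$. (ii) The number of $L$-integral points in $P_{\mathcal{C}}(\lambda,\mu)$ is equal to $\dim(V_\mu)$.
   Context: Fix a positive integer $n$. $\mathfrak{gl}_n$ is the Lie algebra of $n\times n$ complex matrices with elementary matrices $E_{ij}$, and $\mathfrak{h}$ is the subalgebra of diagonal matrices; $\mu=(\mu_1,\dots,\mu_n)$ is identified with the functional in $\mathfrak{h}^*$ sending $E_{kk}$ to $\mu_k$, and $V_\mu=\{v\in V\mid h v=\mu(h)v\text{ for all } h\in\mathfrak{h}\}$. Set $\mathfrak{V}=\{(i,j)\in\mathbb{Z}\times\mathbb{Z}\mid 1\le j\le i\le n\}$; entries of vectors in $\mathbb{C}^{\frac{n(n+1)}{2}}$ are indexed by $\mathfrak{V}$. Let $\mathcal{R}=\mathcal{R}^-\cup\mathcal{R}^0\cup\mathcal{R}^+\subseteq\mathfrak{V}\times\mathfrak{V}$, where $\mathcal{R}^+=\{((i,j);(i-1,t))\mid 2\le i\le n,\ 1\le j\le i,\ 1\le t\le i-1\}$, $\mathcal{R}^-=\{((i,j);(i+1,s))\mid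 1\le j\le i\le n-1,\ 1\le s\le i+1\}$, $\mathcal{R}^0=\{((n,i);(n,j))\mid 1\le i\ne j\le n\}$. A set of relations is any subset $\mathcal{C}\subseteq\mathcal{R}$. $G(\mathcal{C})$ is the directed graph with vertex set $\mathfrak{V}$ and an arrow from $(i,j)$ to $(r,s)$ if and only if $((i,j);(r,s))\in\mathcal{C}$; connected components of $G(\mathcal{C})$ are those of the underlying undirected graph. For $M\in\mathbb{C}^{\frac{n(n+1)}{2}}$, $T(M)$ denotes the triangular configuration (Gelfand--Tsetlin tableau) with $k$th row $(m_{k1},\ldots,m_{kk})$, $1\le k\le n$; tableaux are treated as formal basis symbols. $\mathbb{Z}_0^{\frac{n(n+1)}{2}}$ is the set of $M\in\mathbb{Z}^{\frac{n(n+1)}{2}}$ with $m_{ni}=0$ for $1\le i\le n$. Given a tableau $T(L)$, a tableau $T(M)$, or the point $M$, is called $L$-integral if $M\in L+\mathbb{Z}_0^{\frac{n(n+1)}{2}}$. $T(L)$ satisfies $\mathcal{C}$ if $l_{ij}-l_{rs}\in\mathbb{Z}_{\ge0}$ for every $((i,j);(r,s))\in\mathcal{C}$. $T(L)$ is a $\mathcal{C}$-realization if it satisfies $\mathcal{C}$ and for every $1\le k\le n-1$ one has $l_{ki}-l_{kj}\in\mathbb{Z}$ if and only if $(k,i)$ and $(k,j)$ are in the same connected component of $G(\mathcal{C})$. If $T(L)$ satisfies $\mathcal{C}$, $\mathcal{B}_{\mathcal{C}}(T(L))$ is the set of $L$-integral tableaux satisfying $\mathcal{C}$, and $V_{\mathcal{C}}(T(L))$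 is the free complex vector space with basis $\mathcal{B}_{\mathcal{C}}(T(L))$. $\mathcal{C}$ is admissible if for every $\mathcal{C}$-realization $T(L)$, the space $V_{\mathcal{C}}(T(L))$ is a $\mathfrak{gl}_n$-module under the action given on $T(M)\in\mathcal{B}_{\mathcal{C}}(T(L))$ by $$E_{k,k+1}T(M)=-\sum_{i=1}^k\frac{\prod_{j=1}^{k+1}(m_{ki}-m_{k+1,j}+j-i)}{\prod_{j\ne i}^{k}(m_{ki}-m_{kj}+j-i)}T(M+\delta^{ki}),$$ $$E_{k+1,k}T(M)=\sum_{i=1}^k\frac{\prod_{j=1}^{k-1}(m_{ki}-m_{k-1,j}+j-i)}{\prod_{j\ne i}^{k}(m_{ki}-m_{kj}+j-i)}T(M-\delta^{ki}),$$ $$E_{kk}T(M)=\Big(\sum_{i=1}^k m_{ki}-\sum_{i=1}^{k-1}m_{k-1,i}\Big)T(M),$$ where $(\delta^{ki})_{rs}=\delta_{kr}\delta_{is}$, and a tableau $T(M\pm\delta^{ki})$ not belonging to $\mathcal{B}_{\mathcal{C}}(T(L))$ is read as zero. In that case $V_{\mathcal{C}}(T(L))$, for $T(L)$ a $\mathcal{C}$-realization, is called a relation module. $X\in\mathbb{R}^{\frac{n(n+1)}{2}}$ is a $\mathcal{C}$-pattern if $x_{ij}\ge x_{rs}$ for every $((i,j);(r,s))\in\mathcal{C}$. For $X\in\mathbb{C}^{\frac{n(n+1)}{2}}$ put $R_k(X)=\sum_{i=1}^k x_{ki}$, $w_1(X)=x_{11}$, and $w_k(X)=R_k(X)-R_{k-1}(X)$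 for $2\le k\le n$. For $\lambda,\mu\in\mathbb{R}^n$ the polyhedra associated with $\mathcal{C}$ are $P_{\mathcal{C}}=\{X\in\mathbb{R}^{\frac{n(n+1)}{2}}\mid X\text{ is a }\mathcal{C}\text{-pattern}\}$, $P_{\mathcal{C}}(\lambda)=\{X\in P_{\mathcal{C}}\mid x_{nj}=\lambda_j\text{ for all }1\le j\le n\}$, $P_{\mathcal{C}}(\lambda,\mu)=\{X\in P_{\mathcal{C}}(\lambda)\mid w_i(X)=\mu_i\text{ for all }1\le i\le n\}$.
   Formalization: For non-real L the real polyhedra contain no L-integral points although V is nonzero, so the claim is proved with real polyhedra for real L, and for every complex L with polyhedra of complex tableaux, where x ≥ y means x−y is a nonnegative real. *)

(* Defs.v *)
From HB Require Import structures.
From mathcomp Require Import all_boot all_order all_algebra.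
From mathcomp Require Import finmap boolp classical_sets functions cardinality.
From mathcomp Require Import reals complex monalg.

Set Implicit Arguments.
Unset Strict Implicit.
Unset Printing Implicit Defensive.

Import Order.TTheory GRing.Theory Num.Theory.
Local Open Scope ring_scope.
Local Open Scope classical_set_scope.
Local Open Scope complex_scope.
Local Open Scope card_scope.

(* A vertex is a pair (i, j) with 1 <= j <= i <= n: indices start at 1, the
   value 0 of the ordinals being excluded. *)
Definition vertex (n : nat) :=
  {v : 'I_n.+1 * 'I_n.+1 | (1 <= v.2 <= v.1)%N}.

Definition vrow n (v : vertex n) : nat := (val v).1.
Definition vcol n (v : vertex n) : nat := (val v).2.

Lemma topv_subproof n (j : 'I_n) :
  (1 <= (@ord_max n, lift ord0 j).2 <= (@ord_max n, lift ord0 j).1)%N.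
Proof. exact: (ltn_ord j). Qed.

(* The vertex (n, j + 1). *)
Definition topv n (j : 'I_n) : vertex n :=
  exist _ (ord_max, lift ord0 j) (topv_subproof j).

Definition Rplus n : {set vertex n * vertex n} :=
  [set e | (2 <= vrow e.1)%N && (vrow e.2 == (vrow e.1).-1)]%SET.

Definition Rminus n : {set vertex n * vertex n} :=
  [set e | (vrow e.1 <= n.-1)%N && (vrow e.2 == (vrow e.1).+1)]%SET.

Definition Rzero n : {set vertex n * vertex n} :=
  [set e | [&& vrow e.1 == n, vrow e.2 == n & vcol e.1 != vcol e.2]]%SET.

Definition Rall n : {set vertex n * vertex n} :=
  (Rminus n :|: Rzero n :|: Rplus n)%SET.

Definition same_component n (C : {set vertex n * vertex n}) : rel (vertex n) :=
  connect [rel u v | ((u, v) \in C) || ((v, u) \in C)].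

Notation tableau K n := {ffun vertex n -> K}.

Section Tableaux.
Context (K : numDomainType) (n : nat).
Implicit Types (L M X : tableau K n) (C : {set vertex n * vertex n}).

Definition delta (v : vertex n) : tableau K n := [ffun u => (u == v)%:R].

Definition Z0 : set (tableau int n) :=
  [set Z | forall v, vrow v = n -> Z v = 0].

Definition Lintegral L : set (tableau K n) :=
  [set M | exists2 Z, Z0 Z & M = L + [ffun v => (Z v)%:~R]].

Definition satisfies C L : Prop :=
  forall u v, (u, v) \in C -> exists m : nat, L u - L v = m%:R.

Definition realization C L : Prop :=
  satisfies C L /\
  forall u v, vrow u = vrow v -> (vrow u <= n.-1)%N ->
    ((exists z : int, L u - L v = z%:~R) <-> same_component C u v).

Definition BC C L : set (tableau K n) := Lintegral L `&` satisfies C.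

(* Row 0 is empty, so [rowsum 0 X = 0] and [weight 1 X] is x_11. *)
Definition rowsum (k : nat) X : K := \sum_(v | vrow v == k) X v.
Definition weight (k : nat) X : K := rowsum k X - rowsum k.-1 X.

Definition toprow X : 'rV[K]_n := \row_j X (topv j).
Definition weights X : 'rV[K]_n := \row_(i < n) weight i.+1 X.

(* Over a realType these are the polyhedra of C-patterns.  Over R[i] the order
   is the partial order in which x <= y iff y - x is a nonnegative real; this
   gives a meaning to C-patterns with non-real entries. *)
Definition PC C : set (tableau K n) :=
  [set X | forall u v, (u, v) \in C -> X v <= X u].

Definition PClam C (lam : 'rV[K]_n) : set (tableau K n) :=
  [set X | PC C X /\ forall j, X (topv j) = lam 0 j].

Definition PClammu C (lam mu : 'rV[K]_n) : set (tableau K n) :=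
  [set X | PClam C lam X /\ forall i : 'I_n, weight i.+1 X = mu 0 i].

End Tableaux.

Section Dimension.
Context (K : fieldType) (V : lmodType K).

Definition is_basis (W B : set V) : Prop :=
  [/\ B `<=` W,
      forall (s : seq V) (c : V -> K), uniq s -> (forall x, x \in s -> B x) ->
        \sum_(x <- s) c x *: x = 0 -> forall x, x \in s -> c x = 0 &
      forall w, W w -> exists (s : seq V) (c : V -> K),
        (forall x, x \in s -> B x) /\ w = \sum_(x <- s) c x *: x].

(* The dimension of W, a possibly infinite cardinal, is the cardinality of
   the set S. *)
Definition has_dim (W : set V) (T : Type) (S : set T) : Prop :=
  exists2 B, is_basis W B & S #= B.

End Dimension.

Section RelationModules.
Context (R : realType) (n : nat).
Local Notation gl := 'M[R[i]]_n.
Local Notation tab := (tableau R[i] n).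
Implicit Types (C : {set vertex n * vertex n}) (L M : tab).

(* The elementary matrix with indices starting at 1. *)
Definition elem (k l : nat) : gl :=
  \matrix_(i, j) ((i.+1 == k) && (j.+1 == l))%:R.

Definition is_gl_module (V : lmodType R[i]) (rho : gl -> V -> V) : Prop :=
  [/\ forall A, linear (rho A),
      forall v, linear (rho^~ v) &
      forall A B v,
        rho (A *m B - B *m A) v = rho A (rho B v) - rho B (rho A v)].

(* The free vector space on BC C L. *)
Definition VC C L := {malg R[i][set_type (BC C L)]}.
HB.instance Definition _ C L := GRing.Lmodule.on (VC C L).

(* The basis vector T(M), read as zero when M is not in BC C L. *)
Definition Tvec C L M : VC C L :=
  if insub M is Some b then mkmalgU (b : set_type (BC C L)) 1 else 0.

Definition denom M (v : vertex n) : R[i] :=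
  \prod_(u | (vrow u == vrow v) && (u != v))
     (M v - M u + (vcol u)%:R - (vcol v)%:R).

Definition numer M (v : vertex n) (k : nat) : R[i] :=
  \prod_(u | vrow u == k) (M v - M u + (vcol u)%:R - (vcol v)%:R).

(* No denominator of the Gelfand-Tsetlin formulas vanishes on BC C L. *)
Definition GT_defined C L : Prop :=
  forall M v, BC C L M -> (vrow v <= n.-1)%N -> denom M v != 0.

Definition GT_action C L (rho : gl -> VC C L -> VC C L) : Prop :=
  [/\ forall k M, (1 <= k <= n.-1)%N -> BC C L M ->
        rho (elem k k.+1) (Tvec C L M) =
        - \sum_(v | vrow v == k)
             (numer M v k.+1 / denom M v) *: Tvec C L (M + delta _ v),
      forall k M, (1 <= k <= n.-1)%N -> BC C L M ->
        rho (elem k.+1 k) (Tvec C L M) =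
        \sum_(v | vrow v == k)
             (numer M v k.-1 / denom M v) *: Tvec C L (M - delta _ v) &
      forall k M, (1 <= k <= n)%N -> BC C L M ->
        rho (elem k k) (Tvec C L M) =
        (rowsum k M - rowsum k.-1 M) *: Tvec C L M].

(* The elements E_{k,k+1}, E_{k+1,k}, E_{kk} generate gl_n, so the module
   structure is determined by the formulas. *)
Definition relation_module C L (rho : gl -> VC C L -> VC C L) : Prop :=
  is_gl_module rho /\ GT_action rho.

Definition admissible C : Prop :=
  forall L, realization C L ->
    GT_defined C L /\ exists rho, @relation_module C L rho.

Definition weight_space (V : lmodType R[i]) (rho : gl -> V -> V)
    (mu : 'rV[R[i]]_n) : set V :=
  [set v | forall h : gl, is_diag_mx h ->
             rho h v = (\sum_i mu 0 i * h i i) *: v].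

Definition complex_tableau (X : tableau R n) : tab := [ffun v => (X v)%:C].

End RelationModules.

(* Main.v *)
Require Import Defs.
From mathcomp Require Import all_boot all_order all_algebra.
From mathcomp Require Import boolp classical_sets functions cardinality.
From mathcomp Require Import reals complex.
From mathcomp Require Import finmap monalg.

(** The module V is by construction the free space on the tableaux of
    [BC C L], so everything reduces to identifying sets of tableaux.

    Two points carry the theorem.  First, an L-integral point differs from
    [L] by integers, and [L] satisfies C; hence each difference x_ij - x_rs
    with ((i,j);(r,s)) in C is an integer, and for an integer to be
    nonnegative and to be a natural number is the same thing.  So the
    L-integral points of the polyhedron P_C are exactly the basis tableaux
    ([PC_LintegralE]).  Integral shifts fix the top row, so cutting P_C by the
    top row lam loses no L-integral point ([PClam_LintegralE]).

    Second, the basis tableaux are simultaneous eigenvectors of the diagonal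
    matrices: E_kk acts on T(M) by w_k(M).  Such an operator multiplies the
    coefficient of a vector at T(M) by its eigenvalue there, so a vector has
    weight mu exactly when every tableau of its support has weight mu
    ([weight_spaceE]).  Both V and V_mu are therefore spaces of all vectors
    supported on a given set of basis tableaux, and the dimension of such a
    space is the cardinality of that set ([has_dim_supported]).

    If [L] is real, the embedding of the reals into the complex numbers maps
    the L-integral points of the real polyhedra bijectively to those of the
    complex ones, so the counts are the same. *)

Set Implicit Arguments.
Unset Strict Implicit.
Unset Printing Implicit Defensive.

Import Order.TTheory GRing.Theory Num.Theory.
Local Open Scope ring_scope.
Local Open Scope classical_set_scope.
Local Open Scope card_scope.

(** * Integral points of the polyhedra *)

Section IntegralPoints.
Context (K : numDomainType) (n : nat).
Implicit Types (C : {set vertex n * vertex n}) (L M : tableau K n).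

(** Over the integers, the order conditions defining P_C are the integrality
    conditions defining the basis tableaux. *)
Lemma PC_LintegralE C L :
  satisfies C L -> PC C `&` Lintegral L = BC C L.
Proof.
move=> satL; apply/seteqP; split => M [].
- move=> PCM [Z Z0Z defM]; split; first by exists Z.
  move=> u v uvC; have [m Lm] := satL _ _ uvC.
  have MuvE : M u - M v = (m%:Z + (Z u - Z v))%:~R.
    by rewrite defM !ffunE rmorphD rmorphB /= -pmulrn -Lm addrACA opprD.
  have := PCM u v uvC; rewrite -subr_ge0 MuvE ler0z.
  by case: (_ + _) => // p _; exists p.
- move=> LM satM; split=> // u v uvC.
  by have [m Muv] := satM _ _ uvC; rewrite -subr_ge0 Muv.
Qed.

Lemma Lintegral_toprow L M :
  Lintegral L M -> forall j, M (topv j) = toprow L 0 j.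
Proof.
by move=> [Z Z0Z ->] j; rewrite !mxE !ffunE Z0Z // addr0.
Qed.

Lemma PClam_LintegralE C L :
  PClam C (toprow L) `&` Lintegral L = PC C `&` Lintegral L.
Proof.
apply/seteqP; split=> M [].
- by move=> [].
- by move=> PCM LM; split=> //; split=> //; exact: Lintegral_toprow.
Qed.

Lemma PClammu_LintegralE C L (mu : 'rV[K]_n) :
  PClammu C (toprow L) mu `&` Lintegral L =
  PC C `&` Lintegral L `&` [set M | weights M = mu].
Proof.
rewrite -PClam_LintegralE; apply/seteqP; split=> M.
- by move=> [[PM wM] LM]; split=> //; apply/rowP => i; rewrite mxE wM.
- by move=> [[PM LM] /= <-]; do 2!split=> //; move=> i; rewrite mxE.
Qed.

End IntegralPoints.

(** * Spaces of vectors with prescribed support *)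

Lemma linear_sumZ (K : pzRingType) (U V : lmodType K) (f : U -> V) I
    (r : seq I) (c : I -> K) (x : I -> U) :
  linear f -> f (\sum_(i <- r) c i *: x i) = \sum_(i <- r) c i *: f (x i).
Proof.
move=> flin; elim: r => [|i r IHr]; last by rewrite !big_cons flin IHr.
have := flin (-1) 0 0; rewrite !big_nil scaler0 addr0 scaleN1r => ->.
by rewrite addNr.
Qed.

Section Support.
Context (K : fieldType).

Lemma malg_sumE (T : choiceType) (g : {malg K[T]}) :
  g = \sum_(b <- msupp g) g@_b *: << b >>.
Proof.
rewrite {1}[g]monalgE; apply: eq_bigr => b _; apply/malgP => b'.
by rewrite mcoeffZ !mcoeffU mulr_natr.
Qed.

Lemma mcoeff_sumZ (T : choiceType) I (r : seq I) (c : I -> K)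
    (g : I -> {malg K[T]}) b :
  (\sum_(i <- r) c i *: g i)@_b = \sum_(i <- r) c i * (g i)@_b.
Proof. by rewrite raddf_sum; apply: eq_bigr => i _; exact: mcoeffZ. Qed.

Lemma malgU_inj (T : choiceType) :
  injective (fun b : T => << b >> : {malg K[T]}).
Proof.
move=> b b' /(congr1 (mcoeff b)) /eqP; rewrite !mcoeffU eqxx.
by have [//|_] := eqVneq b' b; rewrite oner_eq0.
Qed.

Lemma is_basis_supported (T : choiceType) (P : set T) :
  is_basis [set g : {malg K[T]} | forall b, g@_b != 0 -> P b]
           ((fun b => << b >>) @` P).
Proof.
split.
- move=> _ [b Pb <-] b' /=; rewrite mcoeffU.
  by have [<- //|_] := eqVneq b b'; rewrite eqxx.
- move=> s c s_uniq sB sum0 x xs; have [b _ xE] := sB _ xs; subst x.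
  have := congr1 (mcoeff b) sum0; rewrite mcoeff_sumZ mcoeff0 => <-.
  rewrite (bigD1_seq _ xs s_uniq) /= mcoeffUU mulr1 big_seq_cond big1 ?addr0 //.
  move=> y /andP[ys yb]; have [b' _ yE] := sB _ ys; subst y.
  rewrite mcoeffU; have [b'b|_] := eqVneq b' b; last by rewrite mulr0.
  by move: yb; rewrite b'b eqxx.
- move=> g Pg; exists [seq << b >> | b <- msupp g].
  (* The coefficient has to be a function of the basis vector; as the index is
     determined by the vector, the sum has at most one term. *)
  exists (fun x => \sum_(b <- msupp g | << b >> == x) g@_b); split.
    move=> _ /mapP[b bg ->]; exists b => //.
    by apply: Pg; rewrite mcoeff_neq0.
  rewrite big_map {1}[g]malg_sumE !big_seq; apply: eq_bigr => b bg.
  congr (_ *: _); under eq_bigl do rewrite (inj_eq (@malgU_inj _)).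
  rewrite big_mkcond (bigD1_seq b bg) ?fset_uniq //= eqxx big1 ?addr0 //.
  by move=> b' /negPf ->.
Qed.

(** Keys are taken in a subtype while [S] lives in the ambient type, so that
    sets of tableaux count dimensions in the free space on [BC C L]. *)
Lemma has_dim_supported (T : choiceType) (A S : set T) :
  S `<=` A ->
  has_dim [set g : {malg K[set_type A]} | forall b, g@_b != 0 -> S (val b)] S.
Proof.
move=> SA; exists ((fun b => << b >>) @` [set b : set_type A | S (val b)]).
  exact: is_basis_supported.
rewrite card_eq_sym; apply: card_eq_trans (inj_card_eq _) _.
  by move=> b b' _ _; exact: malgU_inj.
have imS : val @` [set b : set_type A | S (val b)] = S.
  apply/seteqP; split=> [_ [b Sb <-] //|x Sx].
  by exists (SigSub (mem_set (SA x Sx))).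
rewrite -[X in _ #= X]imS card_eq_sym.
by apply: inj_card_eq => b b' _ _; exact: val_inj.
Qed.

End Support.

Lemma has_dim_card (K : fieldType) (V : lmodType K) (W : set V) T T'
    (S : set T) (S' : set T') :
  S' #= S -> has_dim W S -> has_dim W S'.
Proof. by move=> S'S [B WB SB]; exists B => //; exact: card_eq_trans SB. Qed.

(** * Weight spaces *)

Section Weights.
Context (R : realType) (n : nat) (C : {set vertex n * vertex n}).
Context (L : tableau R[i] n) (rho : 'M[R[i]]_n -> VC C L -> VC C L).
Context (modV : relation_module rho).

Lemma diag_mx_sumE (h : 'M[R[i]]_n) :
  is_diag_mx h -> h = \sum_i h i i *: elem R n i.+1 i.+1.
Proof.
move=> /is_diag_mxP hdiag; apply/matrixP => i j; rewrite summxE.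
rewrite (bigD1 i) //= big1 ?addr0 => [|k ki]; rewrite !mxE !eqSS.
  rewrite eqxx /=; have [->|ij] := eqVneq j i; first by rewrite eqxx mulr1.
  by rewrite hdiag 1?eq_sym // (inj_eq val_inj) eq_sym (negPf ij) mulr0.
by rewrite (inj_eq val_inj) eq_sym (negPf ki) mulr0.
Qed.

Lemma TvecE (b : set_type (BC C L)) : Tvec C L (val b) = << b >>.
Proof. by rewrite /Tvec valK. Qed.

Lemma rho_diagU (h : 'M[R[i]]_n) (b : set_type (BC C L)) :
  is_diag_mx h ->
  rho h << b >> = (\sum_i weights (val b) 0 i * h i i) *: << b >>.
Proof.
case: modV => -[_ lin_l _] [_ _ actK] hd.
rewrite {1}(diag_mx_sumE hd) (linear_sumZ _ _ _ (lin_l _)) scaler_suml.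
apply: eq_bigr => i _; rewrite -TvecE actK ?scalerA ?mxE ?[h i i * _]mulrC //.
  by rewrite ltn_ord.
exact: set_valP.
Qed.

(** The generators E_kk determine the action of every diagonal matrix, and
    since each T(M) is an eigenvector no coefficient mixes with another. *)
Lemma mcoeff_rho_diag (h : 'M[R[i]]_n) (v : VC C L) b :
  is_diag_mx h ->
  (rho h v)@_b = (\sum_i weights (val b) 0 i * h i i) * v@_b.
Proof.
case: modV => -[lin_r _ _] _ hd.
have -> : rho h v = \sum_(b' <- msupp v) v@_b' *: rho h << b' >>.
  by rewrite {1}[v]malg_sumE; exact: linear_sumZ (lin_r h).
have -> : v@_b = \sum_(b' <- msupp v) v@_b' * << b' >>@_b.
  by rewrite {1}[v]malg_sumE mcoeff_sumZ.
rewrite mcoeff_sumZ mulr_sumr; apply: eq_bigr => b' _.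
rewrite rho_diagU // mcoeffZ mcoeffU.
by have [->|_] := eqVneq b' b; [rewrite mulrCA | rewrite !mulr0].
Qed.

(** A vector of weight mu is supported on tableaux of weight mu because an
    eigenvector of an operator acting by scalars on the coefficients has all of
    its support in one eigenvalue, and the matrices E_kk read off the entries of
    a weight one at a time. *)
Lemma weight_spaceE (mu : 'rV[R[i]]_n) :
  weight_space rho mu =
  [set v : VC C L | forall b, v@_b != 0 -> weights (val b) = mu].
Proof.
apply/seteqP; split=> v /= vP.
- move=> b vb0; apply/rowP => k.
  have dk : is_diag_mx (delta_mx k k : 'M[R[i]]_n).
    apply/is_diag_mxP => i j ij; rewrite mxE.
    apply/eqP; rewrite pnatr_eq0 eqb0; apply: contra ij.
    by move=> /andP[/eqP -> /eqP ->].
  have deltaE (nu : 'rV[R[i]]_n) :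
      \sum_i nu 0 i * (delta_mx k k : 'M_n) i i = nu 0 k.
    rewrite (bigD1 k) //= big1 => [|i /negPf ik]; last by rewrite mxE ik mulr0.
    by rewrite mxE !eqxx mulr1 addr0.
  have := congr1 (mcoeff b) (vP _ dk).
  by rewrite mcoeff_rho_diag // mcoeffZ !deltaE => /(mulIf vb0).
- move=> h hd; apply/malgP => b; rewrite mcoeff_rho_diag // mcoeffZ.
  by have [->|/vP ->] := eqVneq (v@_b) 0; rewrite ?mulr0.
Qed.

End Weights.

(** * Comparison with the real polyhedra *)

Section RealTableaux.
Context (R : realType) (n : nat).
Implicit Types (C : {set vertex n * vertex n}) (X L : tableau R n).

Lemma complex_tableau_inj : injective (@complex_tableau R n).
Proof.
move=> X Y /ffunP XY; apply/ffunP => v.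
by have := XY v; rewrite !ffunE => -[].
Qed.

Lemma PC_complex_tableau C X : PC C (complex_tableau X) <-> PC C X.
Proof.
by split=> PX u v /PX; rewrite !ffunE lecR.
Qed.

Lemma Lintegral_complex_tableau L :
  Lintegral (complex_tableau L) = @complex_tableau R n @` Lintegral L.
Proof.
have shiftE (Z : tableau int n) :
    complex_tableau (L + [ffun v => (Z v)%:~R]) =
    complex_tableau L + [ffun v => (Z v)%:~R].
  by apply/ffunP => v; rewrite !ffunE rmorphD rmorph_int.
apply/seteqP; split=> M.
- move=> [Z Z0Z ->]; exists (L + [ffun v => (Z v)%:~R]) => //.
  by exists Z.
- by move=> [_ [Z Z0Z ->] <-]; exists Z.
Qed.

Lemma weights_complex_tableau X :
  weights (complex_tableau X) = map_mx (real_complex R) (weights X).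
Proof.
apply/rowP => i; rewrite !mxE /weight /rowsum rmorphB !rmorph_sum /=.
by congr (_ - _); apply: eq_bigr => v _; rewrite ffunE.
Qed.

Lemma card_PC_complex_tableau C L (D : set (tableau R n))
    (D' : set (tableau R[i] n)) :
  (forall X, D' (complex_tableau X) <-> D X) ->
  PC C `&` Lintegral L `&` D #=
  PC C `&` Lintegral (complex_tableau L) `&` D'.
Proof.
move=> DD'; have -> : PC C `&` Lintegral (complex_tableau L) `&` D' =
    @complex_tableau R n @` (PC C `&` Lintegral L `&` D).
  rewrite Lintegral_complex_tableau; apply/seteqP; split=> M.
  - move=> [[+ [X LX XM]]]; rewrite -XM => /PC_complex_tableau PX /DD' DX.
    by exists X.
  - move=> [X [[PX LX] DX] <-]; split; last exact/DD'.
    by split; [apply/PC_complex_tableau | exists X].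
rewrite card_eq_sym; apply: inj_card_eq => X Y _ _.
exact: complex_tableau_inj.
Qed.

End RealTableaux.

(* The second half is the reading over the real polyhedra, for L real; the
   first half uses the partial order of R[i], so that L may be any
   realization. *)
Theorem theorem4p9 (R : realType) (n : nat) (n_gt0 : (0 < n)%N)
    (C : {set vertex n * vertex n}) (CR : C \subset Rall n)
    (admC : admissible R C)
    (L : tableau R[i] n) (realL : realization C L)
    (rho : 'M[R[i]]_n -> VC C L -> VC C L) (modV : relation_module rho) :
  let lam := toprow L in
  let mu := weights L in
  [/\ PC C `&` Lintegral L #= PClam C lam `&` Lintegral L,
      has_dim (setT : set (VC C L)) (PC C `&` Lintegral L) &
      has_dim (weight_space rho mu) (PClammu C lam mu `&` Lintegral L)] /\
  (forall L0 : tableau R n, L = complex_tableau L0 ->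
   let lam0 := toprow L0 in
   let mu0 := weights L0 in
   [/\ PC C `&` Lintegral L0 #= PClam C lam0 `&` Lintegral L0,
       has_dim (setT : set (VC C L)) (PC C `&` Lintegral L0) &
       has_dim (weight_space rho mu) (PClammu C lam0 mu0 `&` Lintegral L0)]).
Proof.
have satL := realL.1; have PCE := PC_LintegralE satL.
have dimV : has_dim (setT : set (VC C L)) (PC C `&` Lintegral L).
  rewrite PCE; have := has_dim_supported R[i] (@subset_refl _ (BC C L)).
  rewrite (_ : [set g | _] = setT) //; apply/seteqP; split=> // g _ b _.
  exact: set_valP.
have dimVmu : has_dim (weight_space rho (weights L))
    (PC C `&` Lintegral L `&` [set M | weights M = weights L]).
  have sub : BC C L `&` [set M | weights M = weights L] `<=` BC C L.
    exact: subIsetl.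
  rewrite PCE; have := has_dim_supported R[i] sub.
  rewrite (_ : [set g | _] = weight_space rho (weights L)) //.
  rewrite (weight_spaceE modV); apply/seteqP; split=> g gP b gb.
    by have [] := gP b gb.
  by split; [exact: set_valP | exact: gP].
split; first by split; rewrite ?PClam_LintegralE ?PClammu_LintegralE.
move=> L0 LE; rewrite /= PClam_LintegralE PClammu_LintegralE; split=> //.
- apply: has_dim_card dimV; rewrite LE -[X in X #= _]setIT -[X in _ #= X]setIT.
  exact: card_PC_complex_tableau.
- apply: has_dim_card dimVmu; rewrite LE.
  apply: card_PC_complex_tableau => X /=; rewrite !weights_complex_tableau.
  by split=> [|-> //]; exact: map_mx_inj.
Qed.
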